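(* Let $\mathcal{G}=(V,E)$ be a finite tree with at least three vertices, with boundary $\delta\Omega$ (the set of vertices of degree one), and let $L$ be the diameter of $\mathcal{G}$ with respect to the combinatorial distance $d$. Then the first nonzero Steklov eigenvalue $\lambda_2$ of $(\mathcal{G},\delta\Omega)$ satisfies $$\lambda_2\leq \frac{2}{L}.$$ Moreover, let $x_0\sim x_1\sim\cdots\sim x_L$ be a path in $\mathcal{G}$ with $x_0,x_L\in\delta\Omega$ and $d(x_0,x_L)=L$, and for $1\le k\le L-1$ let $\mathcal{G}_k$ be the connected component containing neither $x_0$ nor $x_L$ (that is, the component containing $x_k$) of the graph obtained from $\mathcal{G}$ by removing the edges $(x_{k-1},x_k)$ and $(x_k,x_{k+1})$. If $\lambda_2=\frac{2}{L}$, then: if $L$ is even, $\mathcal{G}_k$ consists of exactly one vertex for every $1\le k\le L-1$ with $k\ne \frac{L}{2}$; and if $L$ is odd, $\mathcal{G}$ is a path.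
   Context: Let $\mathcal{G}=(V,E)$ be a finite tree (simple, undirected, unweighted) with at least three vertices. Its boundary $\delta\Omega$ is the set of vertices of degree one and its interior is $\Omega=V\setminus\delta\Omega$; $|\cdot|$ denotes cardinality. The combinatorial distance $d(x,y)$ is the number of edges in a shortest path from $x$ to $y$. The Steklov problem on $(\mathcal{G},\delta\Omega)$ is: for nonzero $f\in\mathbb{R}^V$ and $\lambda\in\mathbb{R}$, $\Delta f(x)=0$ for $x\in\Omega$ and $\frac{\partial f}{\partial n}(x)=\lambda f(x)$ for $x\in\delta\Omega$, where $(\Delta f)(x)=\sum_{y\sim x}(f(x)-f(y))$ and $\frac{\partial f}{\partial n}(x)=\sum_{y\in\Omega,\,y\sim x}(f(x)-f(y))$. The Steklov eigenvalues are the eigenvalues of the Dirichlet-to-Neumann operator on $\mathbb{R}^{\delta\Omega}$, $f\mapsto \frac{\partial\hat f}{\partial n}$, where $\hat f$ is the harmonic extension of $f$ ($\Delta\hat f=0$ on $\Omega$, $\hat f=f$ on $\delta\Omega$). This operator is self-adjoint and non-negative; its eigenvalues, counted with multiplicity, are ordered $0=\lambda_1\le\lambda_2\le\cdots\le\lambda_{|\delta\Omega|}$. *)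

(* Defs.v *)
From mathcomp Require Import all_boot all_order all_algebra finmap.
From mathcomp Require Import boolp classical_sets cardinality reals.

Set Implicit Arguments.
Unset Strict Implicit.
Unset Printing Implicit Defensive.

Import Order.TTheory GRing.Theory Num.Theory.

Local Open Scope ring_scope.

Section Graph.
Variables (V : finType) (e : rel V).

(* [ucycle e [:: x; y]] holds for any edge, so graph-theoretic cycles are the
   duplicate-free cycles of length at least 3. *)
Definition is_tree : Prop :=
  [/\ symmetric e, irreflexive e, (forall x y, connect e x y)
    & forall p : seq V, ucycle e p -> (size p <= 2)%N].

Definition degree (x : V) : nat := #|[set y | e x y]|.

Definition boundary : {set V} := [set x | degree x == 1%N].

Definition inner : {set V} := ~: boundary.

(* Duplicate-free paths have fewer than #|V| edges, so searching below #|V|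
   loses nothing; the value is #|V| if y is not reachable from x. *)
Definition dist (x y : V) : nat :=
  find (fun n => [exists p : n.-tuple V,
                   [&& path e x p, uniq (x :: p) & last x p == y]])
       (iota 0 #|V|).

Definition diameter : nat := \max_(x : V) \max_(y : V) dist x y.

Definition is_path_graph : Prop :=
  exists2 h : 'I_#|V| -> V, bijective h &
    forall i j : 'I_#|V|,
      e (h i) (h j) = (i.+1 == j :> nat) || (j.+1 == i :> nat).

Definition del_edge (a b : V) : rel V :=
  fun u v => e u v && ~~ ((u == a) && (v == b) || (u == b) && (v == a)).

End Graph.

Definition branch (V : finType) (e : rel V) (x : nat -> V) (k : nat) : {set V} :=
  [set y | connect (del_edge (del_edge e (x k.-1) (x k)) (x k) (x k.+1))
                   (x k) y].

Section Steklov.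
Variables (R : realType) (V : finType) (e : rel V).

Definition laplacian (f : {ffun V -> R^o}) (x : V) : R :=
  \sum_(y | e x y) (f x - f y).

Definition normal_deriv (f : {ffun V -> R^o}) (x : V) : R :=
  \sum_(y in inner e | e x y) (f x - f y).

Definition bdry_fun := {ffun {x : V | x \in boundary e} -> R^o}.

Definition is_harmonic_ext (f : bdry_fun) (F : {ffun V -> R^o}) : Prop :=
  (forall x, x \in inner e -> laplacian F x = 0) /\
  (forall b, F (val b) = f b).

(* On a tree with at least three vertices the harmonic extension exists and is
   unique; 0 is the dummy value when there is none. *)
Definition harmonic_ext (f : bdry_fun) : {ffun V -> R^o} :=
  xget 0 [set F | is_harmonic_ext f F]%classic.

Definition DtN (f : bdry_fun) : bdry_fun :=
  [ffun b => normal_deriv (harmonic_ext f) (val b)].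

(* [linfun DtN] is DtN itself as DtN is linear. It is self-adjoint, so the
   multiplicity of an eigenvalue is the dimension of its eigenspace. *)
Definition steklov_spectrum : seq R :=
  let T := linfun DtN in
  sort <=%R (flatten [seq nseq (\dim (passmx.leigenspace T a)) a
                     | a <- fset_set [set a : R | passmx.leigenvalue T a]%classic]).

(* The k-th Steklov eigenvalue, numbered from k = 1. *)
Definition steklov_eigenvalue (k : nat) : R := steklov_spectrum`_k.-1.

End Steklov.

(* Main.v *)
Require Import Defs.
From HB Require Import structures.
From mathcomp Require Import all_boot all_order all_algebra finmap.
From mathcomp Require Import boolp classical_sets cardinality reals.
From mathcomp Require Import lra ring.

(** The bound comes from one test function.  Fix a path [x 0, ..., x L] realising
    the diameter, and let [level y] be the index of the path vertex onto which
    [y] projects.  This function changes only along the [L] edges of the path, by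
    1 each time, so its Dirichlet energy is [L]; its values at the leaves [x 0]
    and [x L] are 0 and [L], so the sum [q] of squared deviations from its mean
    [m] over the boundary is at least [m ^+ 2 + (L - m) ^+ 2 >= L ^+ 2 / 2].
    Hence the second eigenvalue is at most [L / q <= 2 / L]
    ([lambda2_le_variance], [variance_ge]).

    If it equals [2 / L], then [q = L ^+ 2 / 2], which forces [m = L / 2] and
    forces every other leaf to have level exactly [L / 2] ([leaf_level]).  The
    branch at [x k], for [0 < k < L], has level [k] ([branch_level]), and if it
    is not reduced to [x k] it contains a leaf of the tree ([branch_leaf]); so
    only the branch with [k = L / 2] can be nontrivial.  For odd [L] there is no
    such [k], and the tree is the path.

    The variational bound [lambda2_le_rayleigh] is proved on functions on all of
    the vertices, with no diagonalisation of the Dirichlet-to-Neumann operator: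
    for a large constant [c], let [mu] be the largest number such that the form
    energy + [c] * (boundary sum) ^+ 2 - [mu] * (boundary sum of squares) is
    positive semidefinite.  This form is degenerate, because a nondegenerate
    semidefinite form is coercive ([psd_inj_coercive]) and would allow a larger
    [mu].  A vector in its kernel is an eigenfunction for [mu] with zero boundary
    sum ([rayleigh_eigenfunction]), hence independent of the constants, which
    have eigenvalue 0; so two entries of the spectrum are at most the Rayleigh
    quotient of any test function of zero boundary sum. *)

Set Implicit Arguments.
Unset Strict Implicit.
Unset Printing Implicit Defensive.

Import Order.TTheory GRing.Theory Num.Theory.

(** * Bridges, simple paths and leaves of a tree *)

Section Tree.
Variables (V : finType) (e : rel V).
Hypothesis tree_e : is_tree e.

Lemma tree_sym : symmetric e. Proof. by case: tree_e. Qed.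
Lemma tree_irr : irreflexive e. Proof. by case: tree_e. Qed.
Lemma tree_connect u v : connect e u v. Proof. by case: tree_e. Qed.

Lemma del_edge_connect_sym a b : connect_sym (del_edge e a b).
Proof.
apply: sym_connect_sym => u v; rewrite /del_edge tree_sym orbC.
by rewrite ![(v == _) && _]andbC.
Qed.

(** A detour from [a] to [b] avoiding the edge [a b] would close up with that
    edge into a cycle of length at least 3. *)
Lemma tree_bridge a b : e a b -> ~~ connect (del_edge e a b) a b.
Proof.
move=> eab; apply/negP => /connectP[p0 /shortenP[p ep Up _] defb].
have [_ _ _ /(_ (a :: p))] := tree_e.
have ep' : path e a p by apply: sub_path ep => u v /andP[].
rewrite /ucycle Up /= rcons_path ep' -defb tree_sym eab => /(_ isT).
case: p ep defb {Up ep'} => [|c [|//]] /=.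
  by move=> _ ba; rewrite ba tree_irr in eab.
by move=> + cb; rewrite -cb /del_edge !eqxx andbF.
Qed.

Lemma path_avoid (r : rel V) a u p :
  (forall v w, e v w -> v != a -> w != a -> r v w) ->
  a \notin u :: p -> path e u p -> path r u p.
Proof.
move=> er ap; apply: (@sub_in_path _ (predC1 a)).
  by move=> v w va wa /er; apply.
by apply/allP => v vp /=; apply: contraNneq ap => <-.
Qed.

Lemma del_edge_avoid a b u p :
  a \notin u :: p -> path e u p -> path (del_edge e a b) u p.
Proof.
apply: path_avoid => v w evw va wa.
by rewrite /del_edge evw (negbTE va) (negbTE wa) andbF.
Qed.

(** In a tree simple paths are determined by their ends; the weaker claim that
    their lengths agree already identifies [dist] with the length of any simple
    path, and comparing a path with a single edge shows which neighbours lie on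
    it. *)
Lemma uniq_path_size u p q :
  path e u p -> path e u q -> uniq (u :: p) -> uniq (u :: q) ->
  last u p = last u q -> size p = size q.
Proof.
elim: p u q => [|c p IHp] u [|d q] //=.
- by move=> _ _ _ /andP[+ _] ud; rewrite ud mem_last.
- by move=> _ _ /andP[+ _] _ du; rewrite -du mem_last.
move=> /andP[euc ep] /andP[eud eq] /andP[up Up] /andP[uq Uq] eqlast.
have [cd|cd] := eqVneq c d.
  by subst d; congr _.+1; apply: (IHp c).
(* The walk u, d, ..., last, ..., c avoids the edge from u to c, a bridge. *)
case/negP: (tree_bridge euc).
apply: (@connect_trans _ _ d); last apply: (@connect_trans _ _ (last d q)).
- apply: connect1; rewrite /del_edge eud [d == c]eq_sym (negbTE cd) andbF /=.
  by apply: contraNN uq => /andP[/eqP-> /eqP->]; rewrite mem_head.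
- by apply/connectP; exists q => //; apply: del_edge_avoid.
- rewrite del_edge_connect_sym -eqlast.
  by apply/connectP; exists p => //; apply: del_edge_avoid.
Qed.

Lemma uniq_size_lt (u : V) p : uniq (u :: p) -> (size p < #|V|).
Proof. by move=> /card_uniqP /= <-; apply: max_card. Qed.

Lemma dist_uniq_path u p :
  path e u p -> uniq (u :: p) -> dist e u (last u p) = size p.
Proof.
move=> ep Up; rewrite /dist; set P := (X in find X _).
have lt_p : (size p < #|V|) := uniq_size_lt Up.
have hasP : has P (iota 0 #|V|).
  apply/hasP; exists (size p); first by rewrite mem_iota.
  by apply/existsP; exists (in_tuple p); rewrite ep Up eqxx.
move: (nth_find 0 hasP) (hasP); rewrite has_find size_iota => + lt_i.
rewrite nth_iota // => /existsP[q /and3P[eq Uq /eqP eql]].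
by rewrite -[LHS](size_tuple q); apply: (@uniq_path_size u).
Qed.

Lemma uniq_path_exists u v :
  exists p, [/\ path e u p, uniq (u :: p) & last u p = v].
Proof.
have /connectP[p0 /shortenP[p ep Up _] ->] := tree_connect u v.
by exists p.
Qed.

(** A neighbour of the last vertex lying on the path must be its predecessor,
    since the rest of the path would be a second simple path to it. *)
Lemma last_maximal_path_leaf u p v :
  path e u (rcons p v) -> uniq (u :: rcons p v) ->
  (forall w, e v w -> w \in u :: rcons p v) -> v \in boundary e.
Proof.
move=> ep Up maxp; rewrite inE /degree; apply/eqP.
suff -> : [set w | e v w] = [set last u p] by rewrite cards1.
apply/setP=> w; rewrite !inE; apply/idP/eqP => [evw|->]; last first.
  by move: ep; rewrite rcons_path tree_sym => /andP[].
have := maxp w evw; rewrite -rcons_cons mem_rcons inE => /predU1P[wv|wp].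
  by rewrite wv tree_irr in evw.
case/splitPl: wp ep Up => p1 p2 lastp1.
rewrite last_cat lastp1 rcons_cat cat_path lastp1 => /andP[_ ep2].
rewrite -cat_cons lastI lastp1 cat_rcons cat_uniq => /and3P[_ _ Up2].
have : size (rcons p2 v) = size [:: v].
  apply: (@uniq_path_size w) => //=; rewrite ?last_rcons // ?andbT.
    by rewrite tree_sym.
  by rewrite inE; apply: contraTneq evw => ->; rewrite tree_irr.
by rewrite size_rcons => -[] /size0nil->.
Qed.

Lemma extend_path_to_leaf u p :
  path e u p -> uniq (u :: p) -> p != [::] ->
  exists q, [/\ path e u (p ++ q), uniq (u :: p ++ q)
              & last u (p ++ q) \in boundary e].
Proof.
move: {-1}(#|V| - size p) (leqnn (#|V| - size p)) => n.
elim: n p => [|n IHn] p le_n ep Up pn0.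
  have : (size p < #|V|) := uniq_size_lt Up.
  by rewrite ltnNge -subn_eq0 -leqn0 le_n.
case/lastP: p pn0 le_n ep Up => // p v _ le_n ep Up.
have [/existsP[w /andP[evw wp]]|/existsPn maxp] :=
    boolP [exists w, e v w && (w \notin u :: rcons p v)].
  have ep' : path e u (rcons (rcons p v) w) by rewrite rcons_path ep last_rcons.
  have Up' : uniq (u :: rcons (rcons p v) w).
    by rewrite -rcons_cons rcons_uniq wp.
  have [||q Hq] := IHn _ _ ep' Up'.
  - move: le_n; rewrite !size_rcons [X in (_ <= X -> _)]/= => le_n.
    by rewrite subnS; case: (#|V| - _) le_n.
  - by rewrite -size_eq0 size_rcons.
  by exists (w :: q); rewrite -cat_rcons.
exists [::]; rewrite cats0 ep Up last_rcons; split=> //.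
apply: (last_maximal_path_leaf ep Up) => w evw.
by move: (maxp w); rewrite evw negbK.
Qed.

Lemma rev_uniq_path u p : path e u p -> uniq (u :: p) ->
  [/\ path e (last u p) (rev (belast u p)),
      uniq (last u p :: rev (belast u p))
    & last (last u p) (rev (belast u p)) = u].
Proof.
move=> ep Up; split.
- by rewrite rev_path (eq_path (e' := e)) // => v w; rewrite tree_sym.
- by rewrite -rev_rcons rev_uniq -lastI.
- by case: p {ep Up} => //= v p; rewrite rev_cons last_rcons.
Qed.

Lemma dist_le_diameter u v : dist e u v <= diameter e.
Proof.
apply: leq_trans (leq_bigmax u).
exact: (leq_bigmax (F := fun w => dist e u w)).
Qed.

Lemma diameter_gt0 : 1 < #|V| -> 0 < diameter e.
Proof.
case/card_gt1P=> u [v [_ _ uv]]; apply: leq_trans (dist_le_diameter u v).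
have [p [ep Up lastp]] := uniq_path_exists u v.
rewrite -lastp dist_uniq_path // lt0n size_eq0.
by apply: contraNneq uv => p0; rewrite -lastp p0.
Qed.

(** The longest simple paths realise the diameter, and a longest path cannot be
    extended at either end. *)
Lemma longest_path : 1 < #|V| ->
  exists u p, [/\ path e u p, uniq (u :: p), size p = diameter e,
    u \in boundary e & last u p \in boundary e].
Proof.
move=> card_V.
pose P n := [exists u, exists p : n.-tuple V, path e u p && uniq (u :: p)].
have Pp u p : path e u p -> uniq (u :: p) -> P (size p).
  move=> ep Up; apply/existsP; exists u; apply/existsP; exists (in_tuple p).
  by rewrite ep Up.
have exP : exists n, P n.
  have /card_gt0P[u _] := ltnW card_V.
  by exists 0; apply: (Pp u [::]).
have leP n : P n -> n <= #|V|.
  case/existsP=> u /existsP[p /andP[_ Up]].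
  by rewrite -(size_tuple p) ltnW // (uniq_size_lt Up).
case: (ex_maxnP exP leP) => M /existsP[u /existsP[q /andP[]]].
move: (size_tuple q); case: q => p /= _ szp ep Up maxM.
rewrite -{}szp {M} in maxM *.
have sz_p : size p = diameter e.
  apply/eqP; rewrite eqn_leq; apply/andP; split.
    by rewrite -(dist_uniq_path ep Up) dist_le_diameter.
  apply/bigmax_leqP => v _; apply/bigmax_leqP => w _.
  have [q [eq Uq <-]] := uniq_path_exists v w.
  by rewrite dist_uniq_path //; apply: maxM; apply: Pp eq Uq.
have longest_end v q : path e v q -> uniq (v :: q) -> size q = size p ->
    last v q \in boundary e.
  move=> eq Uq sz_q.
  have qn0 : q != [::] by rewrite -size_eq0 sz_q sz_p -lt0n diameter_gt0.
  have [s [es Us]] := extend_path_to_leaf eq Uq qn0.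
  case: s es Us => [|w s] es Us; first by rewrite cats0.
  have := maxM _ (Pp _ _ es Us); rewrite size_cat sz_q /= addnS.
  by rewrite ltnNge leq_addr.
exists u, p; split=> //; last exact: longest_end.
have [er Ur lastr] := rev_uniq_path ep Up.
by rewrite -lastr; apply: longest_end => //; rewrite size_rev size_belast.
Qed.

Lemma leaf_nbr_eq u v w : u \in boundary e -> e u v -> e u w -> w = v.
Proof.
rewrite inE /degree => /cards1P[c defc] euv euw.
have : v \in [set y | e u y] by rewrite inE.
have : w \in [set y | e u y] by rewrite inE.
by rewrite defc !inE => /eqP-> /eqP->.
Qed.

(** Two adjacent leaves would form a connected component by themselves.  This is
    why the normal derivative, which sums over interior neighbours only, is the
    Laplacian on the boundary. *)
Lemma leaf_nbr_inner (card_V : 2 < #|V|) u v :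
  u \in boundary e -> e u v -> v \in inner e.
Proof.
move=> u_leaf euv; rewrite inE; apply: contraL card_V => v_leaf.
have evu : e v u by rewrite tree_sym.
have cl : closed e [set u; v].
  move=> a b eab; rewrite !inE; apply/pred2P/pred2P => -[] E; move: eab.
  - by rewrite E => /(leaf_nbr_eq u_leaf euv); right.
  - by rewrite E => /(leaf_nbr_eq v_leaf evu); left.
  - by rewrite E tree_sym => /(leaf_nbr_eq u_leaf euv); right.
  - by rewrite E tree_sym => /(leaf_nbr_eq v_leaf evu); left.
rewrite -leqNgt -cardsT; apply: leq_trans (_ : #|[set u; v]| <= 2).
  apply/subset_leq_card/fintype.subsetP => w _.
  by rewrite -(closed_connect cl (tree_connect u w)) !inE eqxx.
by rewrite cards2; case: (_ != _).
Qed.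

(** A walk as short as the distance between its ends cannot be shortened, hence
    repeats no vertex. *)
Lemma geodesic_inj n (x : nat -> V) :
  (forall k, (k < n) -> e (x k) (x k.+1)) -> dist e (x 0) (x n) = n ->
  forall i j, (i <= n) -> (j <= n) -> x i = x j -> i = j.
Proof.
move=> walk_x dist_x.
have ep : path e (x 0) (map x (iota 1 n)).
  apply/(pathP (x 0)) => i; rewrite size_map size_iota => lt_i.
  rewrite -map_cons -/(iota 0 n.+1) !(nth_map 0) ?size_iota //;
    last exact: ltnW.
  by rewrite !nth_iota ?walk_x // ltnW.
have lastp : last (x 0) (map x (iota 1 n)) = x n.
  by rewrite last_map -nth_last size_iota; case: (n) => // m; rewrite nth_iota.
have : uniq (map x (iota 0 n.+1)).
  case: (shortenP ep) lastp => p ep' Up sub_p lastp.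
  apply: (leq_size_uniq Up) => [v|].
    by rewrite !inE => /predU1P[->|/sub_p->]; rewrite ?eqxx ?orbT.
  by rewrite /= -(dist_uniq_path ep' Up) lastp dist_x size_map size_iota.
move=> Ux i j i_n j_n xij; apply/eqP.
have sz : size (map x (iota 0 n.+1)) = n.+1 by rewrite size_map size_iota.
rewrite -(nth_uniq (x 0) _ _ Ux) ?sz ?ltnS //.
by rewrite !(nth_map 0) ?size_iota ?nth_iota // xij.
Qed.

Lemma diametral_walk (card_V : 1 < #|V|) :
  exists x : nat -> V,
  [/\ forall k, (k < diameter e) -> e (x k) (x k.+1),
      dist e (x 0) (x (diameter e)) = diameter e,
      x 0 \in boundary e & x (diameter e) \in boundary e].
Proof.
have [u [p [ep Up <- u_leaf v_leaf]]] := longest_path card_V.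
exists (nth u (u :: p)); rewrite -last_nth.
by split=> //; [apply/pathP | apply: dist_uniq_path].
Qed.

End Tree.

(** * The level function of a path *)

Section LeafPath.
Variables (V : finType) (e : rel V).
Hypothesis tree_e : is_tree e.
Variables (L : nat) (x : nat -> V).
Hypothesis walk_x : forall k, (k < L) -> e (x k) (x k.+1).
Hypothesis inj_x : forall i j, (i <= L) -> (j <= L) -> x i = x j -> i = j.

Let eq_x i j : (i <= L) -> (j <= L) -> (x i == x j) = (i == j).
Proof. by move=> iL jL; apply/eqP/eqP => [/inj_x->|->]. Qed.

Definition separated j y := ~~ connect (del_edge e (x j) (x j.+1)) (x j) y.

(** The index of the vertex of the path [x 0, ..., x L] onto which [y] projects. *)
Definition level y := (\sum_(j < L) separated j y).

Lemma walk_connect (r : rel V) i n :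
  (forall k, (i <= k < i + n) -> r (x k) (x k.+1)) ->
  connect r (x i) (x (i + n)).
Proof.
elim: n => [|n IHn] rx; first by rewrite addn0.
rewrite addnS; apply: connect_trans (IHn _) (connect1 _); last first.
  by apply: rx; rewrite addnS leq_addr /=.
by move=> k /andP[ik kn]; rewrite rx // ik addnS ltnS ltnW.
Qed.

Lemma del_edge_walk j k : (j < L) -> (k < L) -> j != k ->
  del_edge e (x j) (x j.+1) (x k) (x k.+1).
Proof.
move=> jL kL jk; rewrite /del_edge walk_x // !eq_x ?(ltnW jL) ?(ltnW kL) //.
rewrite eqSS [k == j]eq_sym (negbTE jk) /=; apply/negP => /andP[/eqP-> /eqP E].
by move: (leqnSn j.+1); rewrite E ltnn.
Qed.

Lemma separated_walk i j :
  (j < L) -> (i <= L) -> separated j (x i) = (j < i).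
Proof.
move=> jL iL; rewrite /separated; case: leqP => [ij|ji].
  apply/negbF; rewrite del_edge_connect_sym // -(subnKC ij).
  apply: walk_connect => k; rewrite subnKC // => /andP[_ kj].
  by apply: del_edge_walk; rewrite ?(ltn_trans kj) // gtn_eqF.
apply: contra (tree_bridge tree_e (walk_x jL)) => /connect_trans; apply.
rewrite del_edge_connect_sym // -(subnKC ji).
apply: walk_connect => k; rewrite subnKC // => /andP[jk ki].
by apply: del_edge_walk; rewrite ?(leq_trans ki) // ltn_eqF.
Qed.

Lemma separated_connect j u v :
  connect (del_edge e (x j) (x j.+1)) u v -> separated j u = separated j v.
Proof.
have csym := @del_edge_connect_sym _ _ tree_e (x j) (x j.+1).
by move=> uv; rewrite /separated !(csym (x j)) (same_connect csym uv).
Qed.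

Lemma separated_edge u v j : e u v -> separated j u != separated j v ->
  (u == x j) && (v == x j.+1) || (u == x j.+1) && (v == x j).
Proof.
move=> euv; apply: contraNT => uv.
have duv : del_edge e (x j) (x j.+1) u v by rewrite /del_edge euv.
by apply/eqP/separated_connect/connect1.
Qed.

(** The side of edge [j] containing [x j] meets edge [j.+1] nowhere, so this
    connected set lies on one side of it. *)
Lemma separatedS j y : (j.+1 < L) -> separated j.+1 y -> separated j y.
Proof.
move=> jL; apply: contra.
rewrite -[connect _ (x j.+1) y]negbK -/(separated _ y).
have jL' := ltnW jL.
suff cl : closed (del_edge e (x j) (x j.+1))
                 [pred z | connect (del_edge e (x j) (x j.+1)) (x j) z
                           && ~~ separated j.+1 z].
  move=> xy; have := closed_connect cl xy.
  rewrite !inE connect0 xy /= => <-.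
  by rewrite (separated_walk jL (ltnW jL')) -leqNgt leqnSn.
apply: intro_closed => [|u v duv]; first exact: del_edge_connect_sym.
rewrite !inE => /andP[xu su]; have xv := connect_trans xu (connect1 duv).
rewrite xv /=; apply: contra su => sv; case/andP: duv => euv _.
have nsep w : connect (del_edge e (x j) (x j.+1)) (x j) w ->
    (w != x j.+1) && (w != x j.+2).
  move=> xw; apply/andP; split; apply: contraTneq xw => ->.
    by rewrite -/(separated j _) separated_walk // ltnW.
  by rewrite -/(separated j _) separated_walk.
have /andP[/negbTE u1 /negbTE u2] := nsep u xu.
have := @separated_edge u v j.+1 euv; rewrite u1 u2 /= sv.
by case: separated => //= /(_ isT).
Qed.

Lemma levelE k y : (k <= L) -> (0 < k -> separated k.-1 y) ->
  (k < L -> ~~ separated k y) -> level y = k.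
Proof.
move=> kL sep nsep.
have mono i n : (i + n < L) -> separated (i + n) y -> separated i y.
  elim: n => [|n IHn]; rewrite ?addn0 // addnS => inL /separatedS s.
  by apply: IHn; [apply: ltnW | apply: s].
rewrite /level (eq_bigr (fun j : 'I_L => (j < k) : nat)); last first.
  move=> j _; congr nat_of_bool; apply/idP/idP => [sj|jk].
    rewrite ltnNge; apply/negP => kj.
    have /nsep/negP[] : (k < L) by apply: leq_ltn_trans kj _.
    by apply: (mono _ (j - k)); rewrite subnKC.
  case: k kL sep jk {nsep} => // k kL /(_ isT) sk jk.
  by apply: (mono _ (k - j)); rewrite subnKC.
rewrite -(big_mkord xpredT (fun j => (j < k) : nat)) (big_cat_nat _ kL) //=.
rewrite [X in (_ + X)]big_nat_cond [X in (_ + X)]big1 ?addn0; last first.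
  by move=> j /andP[/andP[kj _] _]; rewrite ltnNge kj.
rewrite big_nat_cond (eq_bigr (fun=> 1)); last by move=> j /andP[/andP[_ ->]].
by rewrite -big_nat_cond sum_nat_const_nat subn0 muln1.
Qed.

Lemma level_walk i : (i <= L) -> level (x i) = i.
Proof.
move=> iL; apply: levelE => // [i0|iL']; last by rewrite separated_walk // ltnn.
by rewrite separated_walk ?prednK // -ltnS prednK // ltnS.
Qed.

(** Only an edge of the path can change the level: this makes the Dirichlet
    energy of [level] the number [L] of these edges. *)
Lemma level_edge u v : e u v -> level u != level v ->
  exists2 j, (j < L) &
    (u = x j /\ v = x j.+1) \/ (u = x j.+1 /\ v = x j).
Proof.
move=> euv; rewrite /level.
have [/existsP[j /(separated_edge euv)]|/existsPn sep_eq] :=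
    boolP [exists j : 'I_L, separated j u != separated j v].
  move=> /orP[] /andP[/eqP uj /eqP vj] _; exists j => //; by [left|right].
case/eqP; apply: eq_bigr => j _; congr nat_of_bool.
by apply/eqP; move: (sep_eq j); rewrite negbK.
Qed.

(** The two edges cut off to form the branch are those with index [k.-1] and [k];
    the first separates the branch from [x 0] and the second does not. *)
Lemma branch_level k y : (0 < k < L) -> y \in branch e x k -> level y = k.
Proof.
case/andP=> k0 kL; rewrite inE => xy.
have pkL : (k.-1 < L) by apply: leq_ltn_trans (leq_pred k) kL.
apply: levelE => [|_|_]; first exact: ltnW.
- rewrite -(@separated_connect _ (x k)).
    by rewrite separated_walk ?ltn_predL // ltnW.
  apply: connect_sub xy => u v /andP[+ _]; rewrite prednK //.
  exact: connect1.
- rewrite -(@separated_connect _ (x k)).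
    by rewrite separated_walk ?ltnn // ltnW.
  apply: connect_sub xy => u v /andP[/andP[euv _] uv].
  by apply: connect1; rewrite /del_edge euv.
Qed.

(** A path leaving [x k] inside its branch can be prolonged to a leaf without
    returning to [x k], and both removed edges contain [x k]. *)
Lemma branch_leaf k y : (0 < k < L) -> y \in branch e x k -> y != x k ->
  exists2 z, z \in boundary e & z \in branch e x k.
Proof.
case/andP=> k0 kL; rewrite inE; set H := del_edge _ _ _.
case/connectP=> p0 /shortenP[p Hp Up _] -> xkp.
have eH u v : H u v -> e u v by move=> /andP[/andP[]].
have He u v : e u v -> u != x k -> v != x k -> H u v.
  move=> euv uk vk; rewrite /H /del_edge euv.
  by rewrite (negbTE uk) (negbTE vk) !andbF.
case: p Hp Up xkp => [|b p] /=; first by rewrite eqxx.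
move=> /andP[Hb _] /andP[xb _] _.
have [||//|q [eq Uq lastq]] := @extend_path_to_leaf _ _ tree_e (x k) [:: b].
- by rewrite /= eH.
- rewrite /= andbT; apply: contraNN xb.
  by rewrite inE => /eqP->; rewrite mem_head.
exists (last (x k) ([:: b] ++ q)) => //.
rewrite inE -/H; apply: connect_trans (connect1 Hb) _.
apply/connectP; exists q => //.
case/andP: eq => _ eq; case/andP: Uq => xq _.
exact: path_avoid He xq eq.
Qed.

(** When all branches are trivial the vertex set of the path is closed under
    adjacency, so it is all of [V]. *)
Lemma trivial_branches_path_graph : 0 < L ->
  x 0 \in boundary e -> x L \in boundary e ->
  (forall k y, (0 < k < L) -> y \in branch e x k -> y = x k) ->
  is_path_graph e.
Proof.
move=> L_gt0 x0_leaf xL_leaf triv.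
have injx : injective (fun i : 'I_L.+1 => x i).
  by move=> i j /inj_x E; apply/val_inj/E; rewrite -ltnS ltn_ord.
pose P := [set x i | i : 'I_L.+1].
have xP i : (i <= L) -> x i \in P.
  by move=> iL; apply/imsetP; exists (Ordinal (iL : (i < L.+1))).
have cl : closed e P.
  apply: intro_closed => [|u v + /imsetP[[i iL] _ /= defu]].
    by apply: sym_connect_sym; apply: tree_sym.
  rewrite {u}defu => exv; case: (posnP i) => [i0|i0].
    by subst i; rewrite (leaf_nbr_eq x0_leaf (walk_x L_gt0) exv) xP.
  move: iL; rewrite ltnS leq_eqVlt => /predU1P[iL|iL].
    have exL : e (x L) (x L.-1).
      by rewrite tree_sym // -{2}(prednK L_gt0) walk_x // ltn_predL.
    by subst i; rewrite (leaf_nbr_eq xL_leaf exL exv) xP // leq_pred.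
  have [->|vS] := eqVneq v (x i.+1); first exact: xP.
  have [->|vP] := eqVneq v (x i.-1).
    by rewrite xP // (leq_trans (leq_pred i)) // ltnW.
  rewrite (triv i v) ?i0 ?xP //; first exact: ltnW.
  have /negbTE v_xi : v != x i by apply: contraTneq exv => ->; rewrite tree_irr.
  by rewrite inE connect1 // /del_edge exv v_xi (negbTE vS) (negbTE vP) !andbF.
have PT : P = [set: V].
  apply/setP=> y; rewrite inE.
  by rewrite -(closed_connect cl (tree_connect tree_e (x 0) y)) xP.
have cardV : #|V| = L.+1 by rewrite -cardsT -PT card_imset // card_ord.
have ltL (i : 'I_#|V|) : (i <= L) by rewrite -ltnS -cardV ltn_ord.
exists (fun i : 'I_#|V| => x i).
  apply: inj_card_bij; last by rewrite card_ord.
  by move=> i j /inj_x E; apply/val_inj/E.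
move=> i j; apply/idP/idP => [exx|/orP[/eqP ij|/eqP ji]].
- have [|k kL [[xi xj]|[xi xj]]] := level_edge exx.
  + by rewrite !level_walk //; apply: contraTneq exx => ->; rewrite tree_irr.
  + by rewrite (inj_x (ltL i) (ltnW kL) xi) (inj_x (ltL j) kL xj) eqxx.
  + by rewrite (inj_x (ltL i) kL xi) (inj_x (ltL j) (ltnW kL) xj) eqxx orbT.
- by rewrite -ij walk_x // ij.
- by rewrite -ji tree_sym // walk_x // ji.
Qed.

End LeafPath.

Local Open Scope ring_scope.

(** * Coercivity of positive semidefinite forms *)

Section Coercive.
Variables (R : realFieldType) (T : finType).
Implicit Types f g : {ffun T -> R^o}.

Definition dot f g : R := \sum_i f i * g i.

Lemma dotC f g : dot f g = dot g f.
Proof. by apply: eq_bigr => i _; rewrite mulrC. Qed.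

Lemma dotDl f g h : dot (f + g) h = dot f h + dot g h.
Proof. by rewrite -big_split; apply: eq_bigr => i _; rewrite !ffunE mulrDl. Qed.

Lemma dotZl a f g : dot (a *: f) g = a * dot f g.
Proof. by rewrite mulr_sumr; apply: eq_bigr => i _; rewrite !ffunE mulrA. Qed.

Lemma dotDr f g h : dot h (f + g) = dot h f + dot h g.
Proof. by rewrite !(dotC h) dotDl. Qed.

Lemma dotZr a f g : dot f (a *: g) = a * dot f g.
Proof. by rewrite !(dotC f) dotZl. Qed.

Lemma dot_ge0 f : 0 <= dot f f.
Proof. by apply: sumr_ge0 => i _; rewrite -expr2 sqr_ge0. Qed.

Lemma sqr_le_dot f i : f i ^+ 2 <= dot f f.
Proof.
rewrite /dot (bigD1 i) //= -expr2 lerDl.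
by apply: sumr_ge0 => j _; rewrite -expr2 sqr_ge0.
Qed.

Lemma ffun_sum_delta f :
  f = \sum_i f i *: ([ffun j => (j == i)%:R] : {ffun T -> R^o}).
Proof.
apply/ffunP => j; rewrite sum_ffunE (bigD1 j) //= !ffunE eqxx.
rewrite big1 => [|i ij]; last by rewrite !ffunE eq_sym (negbTE ij) scaler0.
by rewrite addr0 [_ *: _]mulr1.
Qed.

Lemma quadratic_form_bounded (N : 'End({ffun T -> R^o})) :
  exists2 C, 0 < C & forall f, dot f (N f) <= C * dot f f.
Proof.
pose d i : {ffun T -> R^o} := [ffun j => (j == i)%:R].
pose C : R := 1 + \sum_i \sum_j `|N (d j) i|.
have C_gt0 : 0 < C.
  by rewrite ltr_pwDl // sumr_ge0 // => i _; apply: sumr_ge0.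
exists C => // f.
apply: (@le_trans _ _ ((\sum_i \sum_j `|N (d j) i|) * dot f f)); last first.
  by rewrite ler_wpM2r ?dot_ge0 // lerDr.
rewrite mulr_suml; apply: ler_sum => i _.
rewrite [f in N f]ffun_sum_delta linear_sum sum_ffunE mulr_sumr mulr_suml.
apply: ler_sum => j _; rewrite linearZ ffunE -/(d j) [_ *: _]/(_ * _).
have := sqr_le_dot f i; have := sqr_le_dot f j.
move: (f i) (f j) (N (d j) i) (dot f f) => a b n m.
move=> am bm.
have : `|a * b| <= m.
  rewrite ler_norml; have := sqr_ge0 (a + b); have := sqr_ge0 (a - b).
  by move=> *; apply/andP; split; nra.
move=> /(ler_wpM2r (normr_ge0 n)).
rewrite -normrM mulrA mulrC => /(le_trans (ler_norm _)).
by rewrite mulrC [m * _]mulrC.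
Qed.

(** A quantitative form of the fact that a positive semidefinite invertible
    operator is positive definite, which avoids diagonalisation.  With
    [g = B^-1 f] and [dot f g <= C * dot f f], it follows from expanding
    [0 <= dot (B (f - C^-1 g)) (f - C^-1 g)]. *)
Lemma psd_inj_coercive (B : 'End({ffun T -> R^o})) :
  (forall f g, dot (B f) g = dot f (B g)) -> (forall f, 0 <= dot (B f) f) ->
  (forall f, B f = 0 -> f = 0) ->
  exists2 eps, 0 < eps & forall f, eps * dot f f <= dot (B f) f.
Proof.
move=> symB psdB injB.
have kerB : lker B == 0%VS.
  by rewrite -subv0; apply/subvP => f; rewrite memv_ker memv0 => /eqP/injB->.
have [C C_gt0 boundC] := quadratic_form_bounded B^-1%VF.
exists C^-1; first by rewrite invr_gt0.
move=> f; set g := (B^-1)%VF f.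
have Bg : B g = f by apply: lker0_lfunVK.
have := psdB (f + - C^-1 *: g).
rewrite linearD linearZ /= Bg !(dotDl, dotZl, dotDr, dotZr) (symB f g) Bg.
have := boundC f; rewrite -/g => bnd.
have : C^-1 * dot f g <= dot f f by rewrite ler_pdivrMl.
have : 0 < C^-1 by rewrite invr_gt0.
move: C^-1 => c; nra.
Qed.


End Coercive.

(** * Small elements of the spectrum of an endomorphism *)

Section Spectrum.
Variables (R : realFieldType) (W : vectType R).
Implicit Types (T : 'End(W)) (u v : W) (a b r : R).

(** The eigenvalues are roots of the characteristic polynomial. *)
Lemma leigenvalue_finite T :
  finite_set [set a : R | passmx.leigenvalue T a]%classic.
Proof.
have basisW := vbasisP (fullv : {vspace W}).
set A := passmx.mxof (vbasis {:W}) (vbasis {:W}) T.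
have [//|/(infinite_set_fset (size (char_poly A)))[S sub le_S]] :=
  pselect (finite_set [set a : R | passmx.leigenvalue T a]%classic).
suff : (size S < size (char_poly A))%N by rewrite ltnNge le_S.
apply: max_poly_roots; rewrite ?fset_uniq //.
  by rewrite monic_neq0 ?char_poly_monic.
apply/allP => a /sub /=; rewrite /passmx.leigenvalue.
by rewrite (passmx.leigenspaceE basisW) passmx.vsof_eq0 -?eigenvalue_root_char.
Qed.

Lemma mem_leigenspace T a u : T u = a *: u -> u \in passmx.leigenspace T a.
Proof. by move=> Tu; rewrite memv_ker !lfun_simp Tu subrr. Qed.

Lemma sorted_nth1_le (s : seq R) r :
  (1 < count (fun a => (a <= r)%R) s)%N -> (sort <=%R s)`_1 <= r.
Proof.
rewrite -(permP (permEl (perm_sort <=%R s))) => cnt.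
have srt := sort_le_sorted s.
rewrite leNgt; apply/negP => r_lt; move: cnt srt r_lt.
case: (sort _ s) => [|a [|b t]] //=; first by case: (a <= r).
move=> + /andP[_ bt] r_lt; rewrite [b <= r]leNgt r_lt /= add0n.
suff -> : count (fun a0 => a0 <= r) t = 0%N by case: (a <= r).
apply/eqP; rewrite -leqn0 leqNgt -has_count; apply/hasPn => c ct.
move: bt; rewrite (path_sortedE le_trans) => /andP[/allP/(_ c ct) bc _].
by rewrite -ltNge (lt_le_trans r_lt).
Qed.

(** Two independent eigenvectors contribute at least two entries of the list
    that are at most [r], from one eigenspace or from two. *)
Lemma second_eigenvalue_le T a b r u v :
  T u = a *: u -> T v = b *: v -> free [:: u; v] -> a <= r -> b <= r ->
  (sort <=%R (flatten [seq nseq (\dim (passmx.leigenspace T c)) c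
     | c <- fset_set [set c : R | passmx.leigenvalue T c]%classic]))`_1 <= r.
Proof.
move=> Tu Tv uv_free ar br; apply: sorted_nth1_le.
set E := fset_set _.
have /mem_leigenspace uE := Tu; have /mem_leigenspace vE := Tv.
have u0 : u != 0 by apply: contraTneq uv_free => ->; rewrite free_cons mem0v.
have v0 : v != 0.
  by apply: contraTneq uv_free => ->; rewrite free_cons seq1_free eqxx andbF.
have memE c w : w != 0 -> w \in passmx.leigenspace T c -> c \in E.
  move=> w0 wc; rewrite in_fset_set; last exact: leigenvalue_finite.
  by rewrite inE /=; apply: contraNneq w0 => E0; rewrite -memv0 -E0.
have dim_gt0 c w : w != 0 -> w \in passmx.leigenspace T c ->
    (0 < \dim (passmx.leigenspace T c))%N.
  move=> w0 wc; rewrite lt0n dimv_eq0; apply: contraNneq w0 => E0.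
  by rewrite -memv0 -E0.
rewrite count_flatten -map_comp sumnE big_map.
rewrite (bigD1_seq a) ?fset_uniq ?(memE a u) //= count_nseq ar mul1n.
have [ab|ab] := eqVneq b a.
  apply: leq_trans (leq_addr _ _); rewrite ab in vE.
  have /eqP dim_uv := uv_free.
  apply: (@leq_trans (\dim <<[:: u; v]>>)); first by rewrite dim_uv.
  apply: dimvS; rewrite span_cons span_seq1.
  by rewrite subv_add -!memvE uE.
rewrite -addn1 leq_add ?(dim_gt0 _ u) //.
rewrite -big_filter (bigD1_seq b) ?filter_uniq ?fset_uniq //=; last first.
  by rewrite mem_filter ab (memE b v).
by rewrite count_nseq br mul1n ltn_addr ?(dim_gt0 _ v).
Qed.

End Spectrum.

(** * Rayleigh quotients and the second Steklov eigenvalue *)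

Section TreeSteklov.
Variables (R : realType) (V : finType) (e : rel V).
Hypothesis tree_e : is_tree e.
Local Notation bd := (boundary e).
Implicit Types (F G : {ffun V -> R^o}) (t c r : R).

(** Every edge is counted in both directions, so this is twice the energy. *)
Definition dirichlet F G : R :=
  \sum_u \sum_(v | e u v) (F u - F v) * (G u - G v).

Lemma dirichlet_ge0 F : 0 <= dirichlet F F.
Proof.
by do 2!(apply: sumr_ge0 => ? _); rewrite -expr2 sqr_ge0.
Qed.

Lemma dirichletC F G : dirichlet F G = dirichlet G F.
Proof. by do 2!(apply: eq_bigr => ? _); rewrite mulrC. Qed.

(** Summation by parts: adding the left-hand side to itself with the two ends
    of each edge exchanged gives the Dirichlet form. *)
Lemma green F G : \sum_u laplacian e F u * G u = 2^-1 * dirichlet F G.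
Proof.
apply: (canRL (mulKf _)); first by rewrite pnatr_eq0.
rewrite mulr_natl mulr2n.
rewrite {2}/laplacian; under [X in _ + X]eq_bigr do rewrite mulr_suml.
rewrite (exchange_big_dep xpredT) //=.
rewrite -big_split; apply: eq_bigr => u _ /=.
under [X in _ + X]eq_bigl do rewrite (tree_sym tree_e).
rewrite mulr_suml -big_split; apply: eq_bigr => v _ /=; ring.
Qed.

Lemma dirichlet_eq0 F u v : dirichlet F F = 0 -> F u = F v.
Proof.
move=> F0; have nbr a b : e a b -> F a = F b.
  move=> eab; apply/eqP; rewrite -subr_eq0 -sqrf_eq0 expr2.
  have ge0 x y : 0 <= (F x - F y) * (F x - F y) by rewrite -expr2 sqr_ge0.
  have := F0; move/eqP; rewrite psumr_eq0 => [|x _]; last exact: sumr_ge0.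
  move=> /allP/(_ a); rewrite mem_index_enum /= => /(_ isT).
  rewrite psumr_eq0 // => /allP/(_ b).
  by rewrite mem_index_enum eab => /(_ isT).
have cl : closed e [pred w | F u == F w].
  by move=> a b /nbr; rewrite !inE => ->.
apply/eqP; move: (closed_connect cl (tree_connect tree_e u v)).
by rewrite !inE eqxx.
Qed.

Lemma laplacian_linear u : linear ((laplacian e)^~ u : {ffun V -> R^o} -> R^o).
Proof.
move=> c F G; rewrite scaler_sumr -big_split; apply: eq_bigr => v _ /=.
by rewrite !ffunE /GRing.scale /=; ring.
Qed.

Definition bd_sum F : R := \sum_(v in bd) F v.

(** The operator of the quadratic form
    [F |-> dirichlet F F / 2 + c * (bd_sum F) ^+ 2 - t * \sum_(v in bd) F v ^+ 2]
    on functions on all of [V].  The term with [c] penalises nonzero boundary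
    sums, so that the constants do not give the lowest eigenvalue. *)
Definition steklov_op c t F : {ffun V -> R^o} :=
  [ffun v => laplacian e F v + (v \in bd)%:R * (c * bd_sum F - t * F v)].

Lemma bd_sum_linear : linear (bd_sum : {ffun V -> R^o} -> R^o).
Proof.
move=> c F G; rewrite scaler_sumr -big_split; apply: eq_bigr => v _ /=.
by rewrite !ffunE.
Qed.

Lemma steklov_op_linear c t : linear (steklov_op c t).
Proof.
move=> a F G; apply/ffunP => v.
rewrite !ffunE laplacian_linear bd_sum_linear /GRing.scale /=; ring.
Qed.
HB.instance Definition _ c t :=
  GRing.isLinear.Build R _ _ _ (steklov_op c t) (steklov_op_linear c t).

Lemma dot_steklov_op c t F G :
  dot (steklov_op c t F) G
    = 2^-1 * dirichlet F G + c * (bd_sum F * bd_sum G)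
      - t * \sum_(v in bd) F v * G v.
Proof.
rewrite -green /dot; under eq_bigr do rewrite ffunE mulrDl.
rewrite big_split -addrA; congr (_ + _).
rewrite mulrA !mulr_sumr -sumrB [RHS]big_mkcond; apply: eq_bigr => v _ /=.
by case: (v \in bd) => /=; ring.
Qed.

(** The eigenvalue is the largest [mu] for which the form of [steklov_op c mu] is
    positive semidefinite.  It is at most [r] because of [F0].  The operator is
    singular at [mu]: otherwise its form would be coercive and [mu] could be
    increased.  A kernel vector is harmonic off the boundary, and pairing it
    with the constant 1 shows that its boundary sum vanishes. *)
Lemma rayleigh_eigenfunction r F0 :
  0 <= r -> bd_sum F0 = 0 -> 0 < \sum_(v in bd) F0 v ^+ 2 ->
  2^-1 * dirichlet F0 F0 <= r * \sum_(v in bd) F0 v ^+ 2 ->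
  exists mu F, [/\ mu <= r, F != 0, bd_sum F = 0 &
    forall v, laplacian e F v = (v \in bd)%:R * (mu * F v)].
Proof.
move=> r_ge0 sumF0 F0_gt0 rayF0.
have half_D_ge0 F : 0 <= 2^-1 * dirichlet F F.
  by rewrite mulr_ge0 ?dirichlet_ge0 ?invr_ge0.
have sq_ge0 F : 0 <= \sum_(v in bd) F v ^+ 2.
  by apply: sumr_ge0 => v _; rewrite sqr_ge0.
(* Any c > r >= mu makes mu - c * #|bd| nonzero below. *)
pose c := r + 1.
pose S := [set t | 0 <= t /\ forall F, t * (\sum_(v in bd) F v ^+ 2)
   <= 2^-1 * dirichlet F F + c * bd_sum F ^+ 2]%classic.
have S0 : S 0.
  split=> // F; rewrite mul0r addr_ge0 // mulr_ge0 ?sqr_ge0 //.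
  by rewrite addr_ge0.
have ubS : ubound S r.
  move=> t [_ /(_ F0)]; rewrite sumF0 expr0n mulr0 addr0 => /le_trans/(_ rayF0).
  by rewrite ler_pM2r.
have S_neq0 : (S !=set0)%classic by exists 0.
have supS : has_sup S by split=> //; exists r.
pose mu := sup S.
have mu_ge0 : 0 <= mu by apply: (sup_upper_bound supS).
have Smu F : mu * (\sum_(v in bd) F v ^+ 2)
   <= 2^-1 * dirichlet F F + c * bd_sum F ^+ 2.
  have [F_0|F_neq0] := eqVneq (\sum_(v in bd) F v ^+ 2) 0.
    by have [_ /(_ F)] := S0; rewrite F_0 !mulr0.
  have F_gt0 : 0 < \sum_(v in bd) F v ^+ 2 by rewrite lt_def F_neq0 sq_ge0.
  rewrite -ler_pdivlMr //; apply: ge_sup => // t [_ /(_ F)].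
  by rewrite ler_pdivlMr.
pose B := linfun (steklov_op c mu).
have sqE F : \sum_(v in bd) F v * F v = \sum_(v in bd) F v ^+ 2 by [].
have symB F G : dot (B F) G = dot F (B G).
  rewrite [RHS]dotC !lfunE /= !dot_steklov_op dirichletC [bd_sum F * _]mulrC.
  by congr (_ - _ * _); apply: eq_bigr => v _; rewrite mulrC.
have psdB F : 0 <= dot (B F) F.
  by rewrite lfunE /= dot_steklov_op sqE -expr2 subr_ge0.
have [F BF F_neq0] : exists2 F, B F = 0 & F != 0.
  apply: contrapT => noF; have injB F : B F = 0 -> F = 0.
    by move=> BF; apply/eqP; apply: contra_notT noF => F_neq0; exists F.
  have [eps eps_gt0 coercive] := psd_inj_coercive symB psdB injB.
  have : S (mu + eps).
    split=> [|F]; first by rewrite addr_ge0 // ltW.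
    have := coercive F; rewrite lfunE /= dot_steklov_op sqE -expr2.
    have : eps * \sum_(v in bd) F v ^+ 2 <= eps * dot F F.
      rewrite ler_pM2l // /dot [leLHS]big_mkcond; apply: ler_sum => v _.
      by case: ifP => _; rewrite // -expr2 sqr_ge0.
    by rewrite mulrDl; lra.
  by move=> /(sup_upper_bound supS); rewrite gerDl leNgt eps_gt0.
have lapF v : laplacian e F v = (v \in bd)%:R * (mu * F v - c * bd_sum F).
  have /ffunP/(_ v) := BF; rewrite lfunE !ffunE /= => /(canRL (addrK _)) ->.
  by rewrite add0r -mulrN opprB.
have mu_le_r : mu <= r by apply: ge_sup.
exists mu, F; suff sumF : bd_sum F = 0.
  by split=> // v; rewrite lapF sumF mulr0 subr0.
have : dot (steklov_op c mu F) [ffun=> 1] = 0.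
  by move: BF; rewrite lfunE /= => ->; rewrite -(scale0r 0) dotZl mul0r.
rewrite dot_steklov_op [dirichlet _ _]big1 => [|u _]; last first.
  by rewrite big1 // => v _; rewrite !ffunE subrr mulr0.
under [X in _ - _ * X]eq_bigr do rewrite ffunE mulr1.
rewrite -/(bd_sum F) mulr0 add0r {2}/bd_sum.
under [X in _ * (_ * X)]eq_bigr do rewrite ffunE.
rewrite sumr_const mulrCA [_ * bd_sum F]mulrC -mulrBr => /eqP.
rewrite mulf_eq0 => /predU1P[//|/eqP bd_mu].
have bd_gt0 : (0 < #|bd|)%N.
  rewrite lt0n; apply: contraTneq F0_gt0 => bd0.
  rewrite big_pred0 ?ltxx // => v; exact: card0_eq.
have : 1 <= #|bd|%:R :> R by rewrite ler1n.
by move: bd_mu; rewrite /c; nra.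
Qed.

Variable card_V : (2 < #|V|)%N.
Variable b0 : V.
Hypothesis b0_leaf : b0 \in bd.

Lemma normal_deriv_laplacian F v :
  v \in bd -> normal_deriv e F v = laplacian e F v.
Proof.
move=> v_leaf; apply: eq_bigl => w; apply: andb_idl.
exact: (leaf_nbr_inner tree_e card_V).
Qed.

(** The Dirichlet problem as a square system: boundary values on leaves,
    harmonicity elsewhere.  Injectivity then gives both existence and uniqueness
    of harmonic extensions. *)
Definition dirichlet_op F : {ffun V -> R^o} :=
  [ffun v => if v \in bd then F v else laplacian e F v].

Lemma dirichlet_op_linear : linear dirichlet_op.
Proof.
move=> a F G; apply/ffunP => v; rewrite !ffunE.
by case: ifP => // _; rewrite laplacian_linear.
Qed.
HB.instance Definition _ :=
  GRing.isLinear.Build R _ _ _ dirichlet_op dirichlet_op_linear.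

(** A harmonic function with zero boundary values has zero energy, hence is
    constant. *)
Lemma dirichlet_op_inj F : dirichlet_op F = 0 -> F = 0.
Proof.
move=> /ffunP HF.
have bd0 v : v \in bd -> F v = 0 by move=> vb; have := HF v; rewrite !ffunE vb.
have : dirichlet F F = 0.
  apply: (@mulfI _ 2^-1); first by rewrite invr_eq0 pnatr_eq0.
  rewrite mulr0 -green big1 // => v _; have := HF v; rewrite !ffunE.
  by case: ifP => [/bd0-> _|_ ->]; rewrite ?mulr0 ?mul0r.
by move=> D0; apply/ffunP => v; rewrite (dirichlet_eq0 v b0 D0) bd0 // ffunE.
Qed.

Lemma harmonic_ext_exists (f : bdry_fun R e) : exists F, is_harmonic_ext f F.
Proof.
pose H := linfun dirichlet_op.
have kerH : lker H == 0%VS.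
  rewrite -subv0; apply/subvP => F; rewrite memv_ker memv0 lfunE /=.
  by move=> /eqP/dirichlet_op_inj->.
pose g : {ffun V -> R^o} := [ffun v => oapp f 0 (insub v)].
exists ((H^-1)%VF g); set F := (H^-1)%VF g.
have /ffunP HF : dirichlet_op F = g by rewrite -[LHS]lfunE; apply: lker0_lfunVK.
split=> [v|b].
  rewrite inE => vI; have := HF v; rewrite !ffunE (negbTE vI) => ->.
  by rewrite insubN.
by have := HF (val b); rewrite !ffunE (valP b) valK.
Qed.

Lemma harmonic_extP (f : bdry_fun R e) : is_harmonic_ext f (harmonic_ext f).
Proof.
have [F HF] := harmonic_ext_exists f.
by apply: (xgetPex 0 (P := is_harmonic_ext f)); exists F.
Qed.

Lemma harmonic_ext_eq (f : bdry_fun R e) F :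
  is_harmonic_ext f F -> harmonic_ext f = F.
Proof.
have [HI Hb] := harmonic_extP f => -[FI Fb].
apply/eqP; rewrite -subr_eq0; apply/eqP/dirichlet_op_inj/ffunP => v.
have := linearB dirichlet_op (harmonic_ext f) F => /= ->; rewrite !ffunE.
case: ifPn => vb; last by rewrite HI ?FI ?subrr // inE.
by rewrite (Hb (Sub v vb)) (Fb (Sub v vb)) subrr.
Qed.

(** Uniqueness of harmonic extensions gives linearity, without which
    [linfun DtN], whose spectrum is studied, would not be [DtN]. *)
Lemma DtN_linear : linear (@DtN R V e).
Proof.
move=> a f g; apply/ffunP => b.
rewrite !ffunE !normal_deriv_laplacian ?(valP b) //.
rewrite -[X in _ = X]laplacian_linear; congr laplacian; apply: harmonic_ext_eq.
have [fI fb] := harmonic_extP f; have [gI gb] := harmonic_extP g.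
split=> [v vI|d]; last by rewrite !ffunE fb gb.
by rewrite laplacian_linear fI // gI // scaler0 addr0.
Qed.
HB.instance Definition _ :=
  GRing.isLinear.Build R _ _ _ (@DtN R V e) DtN_linear.

Lemma DtN_eigenfunction mu F :
  (forall v, laplacian e F v = (v \in bd)%:R * (mu * F v)) ->
  DtN [ffun b : {v | v \in bd} => F (val b)] = mu *: [ffun b => F (val b)].
Proof.
move=> lapF; apply/ffunP => b.
have HF : is_harmonic_ext [ffun b : {v | v \in bd} => F (val b)] F.
  split=> [v|d]; last by rewrite ffunE.
  by rewrite inE lapF => /negbTE->; rewrite mul0r.
rewrite !ffunE (harmonic_ext_eq HF) normal_deriv_laplacian ?(valP b) //.
by rewrite lapF (valP b) mul1r.
Qed.

(** The eigenfunction given by [rayleigh_eigenfunction] and the constant 1, of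
    eigenvalue 0, are independent because the former has zero boundary sum. *)
Lemma lambda2_le_rayleigh r F0 :
  0 <= r -> bd_sum F0 = 0 -> 0 < \sum_(v in bd) F0 v ^+ 2 ->
  2^-1 * dirichlet F0 F0 <= r * \sum_(v in bd) F0 v ^+ 2 ->
  steklov_eigenvalue R e 2 <= r.
Proof.
move=> r_ge0 sumF0 F0_gt0 rayF0.
have [mu [F [mu_le F_neq0 sumF lapF]]] :=
  rayleigh_eigenfunction r_ge0 sumF0 F0_gt0 rayF0.
have lap1 v :
    laplacian e [ffun=> 1] v = (v \in bd)%:R * (0 * [ffun=> 1 : R^o] v).
  by rewrite mul0r mulr0 [LHS]big1 // => w _; rewrite !ffunE subrr.
have eq1 := DtN_eigenfunction lap1; have eqF := DtN_eigenfunction lapF.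
set g1 := finfun _ in eq1; set gF := finfun _ in eqF.
apply: (@second_eigenvalue_le _ _ (linfun (@DtN R V e)) 0 mu r g1 gF);
  rewrite ?lfunE //.
have gF_neq0 : gF != 0.
  apply: contraNneq F_neq0 => gF0; apply/eqP/dirichlet_op_inj/ffunP => v.
  rewrite !ffunE; case: ifPn => vb; last by rewrite lapF (negbTE vb) mul0r.
  by have /ffunP/(_ (Sub v vb)) := gF0; rewrite !ffunE.
rewrite free_cons seq1_free gF_neq0 andbT span_seq1; apply/vlineP => -[k g1E].
have Fk v : v \in bd -> 1 = k * F v.
  by move=> vb; have /ffunP/(_ (Sub v vb)) := g1E; rewrite !ffunE.
have : \sum_(v in bd) (1 : R) = 0.
  by rewrite (eq_bigr _ Fk) -mulr_sumr -/(bd_sum F) sumF mulr0.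
rewrite sumr_const => /eqP; rewrite pnatr_eq0 => /eqP/card0_eq/(_ b0).
by rewrite b0_leaf.
Qed.

End TreeSteklov.

(** * The level function as a test function *)

Section DiametralTest.
Variables (R : realType) (V : finType) (e : rel V).
Hypothesis tree_e : is_tree e.
Hypothesis card_V : (2 < #|V|)%N.
Variables (L : nat) (x : nat -> V).
Hypothesis L_gt0 : (0 < L)%N.
Hypothesis walk_x : forall k, (k < L)%N -> e (x k) (x k.+1).
Hypothesis inj_x : forall i j, (i <= L)%N -> (j <= L)%N -> x i = x j -> i = j.
Hypothesis x0_leaf : x 0%N \in boundary e.
Hypothesis xL_leaf : x L \in boundary e.
Local Notation bd := (boundary e).
Local Notation lev := (level e L x).

Definition bd_mean : R := (\sum_(v in bd) (lev v)%:R) / #|bd|%:R.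

(** Centring makes the boundary sum vanish, as a test function for [lambda_2]
    must; it does not change the energy. *)
Definition centred_level : {ffun V -> R^o} := [ffun v => (lev v)%:R - bd_mean].

Definition bd_variance : R := \sum_(v in bd) centred_level v ^+ 2.

Lemma bd_sum_centred_level : bd_sum e centred_level = 0.
Proof.
rewrite /bd_sum; under eq_bigr do rewrite ffunE.
rewrite sumrB sumr_const -mulr_natr divfK ?subrr //.
by rewrite pnatr_eq0 -lt0n; apply/card_gt0P; exists (x 0).
Qed.

Lemma sum_pair_indicator (a b : V) :
  \sum_u \sum_v ((u == a) && (v == b))%:R = 1 :> R.
Proof.
rewrite (bigD1 a) //= (bigD1 b) //= !eqxx big1 => [|v /negbTE->]; last by [].
rewrite big1 => [|u /negbTE->]; first by rewrite !addr0.
by rewrite big1.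
Qed.

Lemma dirichlet_centred_level :
  2^-1 * dirichlet e centred_level centred_level <= L%:R.
Proof.
rewrite ler_pdivrMl //.
pose I u v j : R := ((u == x j) && (v == x j.+1))%:R
                  + ((u == x j.+1) && (v == x j))%:R.
have I_ge0 u v j : 0 <= I u v j by rewrite addr_ge0.
apply: (@le_trans _ _ (\sum_u \sum_v \sum_(j < L) I u v j)); last first.
  rewrite (eq_bigr _ (fun u _ => exchange_big _ _ _ _ _ _)) exchange_big /=.
  rewrite (eq_bigr (fun=> 2)) => [|j _]; last first.
    under eq_bigr do rewrite big_split /=.
    by rewrite big_split /= !sum_pair_indicator.
  by rewrite sumr_const card_ord mulr_natr.
apply: ler_sum => u _; rewrite big_mkcond; apply: ler_sum => v _.
case: ifP => [euv|_]; last by apply: sumr_ge0.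
rewrite !ffunE; have [->|] := eqVneq (lev u) (lev v).
  by rewrite subrr mul0r; apply: sumr_ge0.
move=> /(level_edge tree_e euv)[j jL uv].
rewrite (bigD1 (Ordinal jL)) //= -[leLHS]addr0 lerD ?sumr_ge0 // /I.
case: uv => -[-> ->]; rewrite !(level_walk tree_e walk_x inj_x) ?(ltnW jL) //.
  by rewrite !eqxx (_ : _ * _ = 1) ?lerDl //; rewrite -natr1; ring.
by rewrite !eqxx (_ : _ * _ = 1) ?lerDr //; rewrite -natr1; ring.
Qed.

Lemma sqr_pair_le_variance :
  centred_level (x 0) ^+ 2 + centred_level (x L) ^+ 2 <= bd_variance.
Proof.
have x0L : x L != x 0.
  by apply/eqP => /inj_x E; move: L_gt0; rewrite E.
rewrite /bd_variance (bigD1 (x 0)) //= (bigD1 (x L)) ?xL_leaf //= addrA lerDl.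
by apply: sumr_ge0 => v _; apply: sqr_ge0.
Qed.

Lemma sqr_triple_le_variance z : z \in bd -> z != x 0 -> z != x L ->
  centred_level (x 0) ^+ 2 + centred_level (x L) ^+ 2 + centred_level z ^+ 2
    <= bd_variance.
Proof.
move=> z_leaf z0 zL; have x0L : x L != x 0.
  by apply/eqP => /inj_x E; move: L_gt0; rewrite E.
rewrite /bd_variance (bigD1 (x 0)) //= (bigD1 (x L)) ?xL_leaf //=.
rewrite (bigD1 z) ?z_leaf ?z0 //= !addrA lerDl.
by apply: sumr_ge0 => v _; apply: sqr_ge0.
Qed.

Lemma centred_level_ends :
  (centred_level (x 0) = - bd_mean) * (centred_level (x L) = L%:R - bd_mean).
Proof.
by rewrite !ffunE !(level_walk tree_e walk_x inj_x) // sub0r.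
Qed.

(** The two ends alone contribute [bd_mean ^+ 2 + (L - bd_mean) ^+ 2], which is
    smallest at [bd_mean = L / 2]. *)
Lemma variance_ge : L%:R ^+ 2 / 2 <= bd_variance.
Proof.
apply: le_trans sqr_pair_le_variance; rewrite !centred_level_ends.
rewrite ler_pdivrMr //; have := sqr_ge0 (2 * bd_mean - L%:R); nra.
Qed.

Lemma variance_gt0 : 0 < bd_variance.
Proof.
by apply: lt_le_trans variance_ge; rewrite divr_gt0 ?exprn_gt0 // ltr0n.
Qed.

Lemma lambda2_le_variance : steklov_eigenvalue R e 2 <= L%:R / bd_variance.
Proof.
apply: (lambda2_le_rayleigh tree_e card_V x0_leaf (F0 := centred_level)).
- by rewrite divr_ge0 ?ler0n // ltW // variance_gt0.
- exact: bd_sum_centred_level.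
- exact: variance_gt0.
- by rewrite divfK ?gt_eqF ?variance_gt0 // dirichlet_centred_level.
Qed.

Lemma lambda2_le_length : steklov_eigenvalue R e 2 <= 2 / L%:R.
Proof.
apply: le_trans lambda2_le_variance _.
have L0 : 0 < L%:R :> R by rewrite ltr0n.
rewrite ler_pdivrMr ?variance_gt0 // mulrAC ler_pdivlMr //.
by have := variance_ge; rewrite ler_pdivrMr //; lra.
Qed.

Section Equality.
Hypothesis lambda2E : steklov_eigenvalue R e 2 = 2 / L%:R.

(** Equality leaves no room in the variance: a further leaf adds the square of
    its centred level, which must be 0, and [bd_mean] must be [L / 2]. *)
Lemma leaf_level z : z \in bd -> z != x 0 -> z != x L -> (lev z).*2 = L.
Proof.
move=> z_leaf z0 zL; have L0 : 0 < L%:R :> R by rewrite ltr0n.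
have := lambda2_le_variance; rewrite lambda2E.
rewrite ler_pdivlMr ?variance_gt0 // mulrAC ler_pdivrMr // => var_le.
have := sqr_triple_le_variance z_leaf z0 zL.
rewrite !centred_level_ends ffunE => le_var.
have sqr_le0 (a : R) : a ^+ 2 <= 0 -> a = 0.
  by move=> a2; apply/eqP; rewrite -sqrf_eq0 eq_le a2 sqr_ge0.
have [] : (lev z)%:R - bd_mean = 0 /\ 2 * bd_mean - L%:R = 0.
  have := sqr_ge0 ((lev z)%:R - bd_mean); have := sqr_ge0 (2 * bd_mean - L%:R).
  by move=> ? ?; split; apply: sqr_le0; nra.
move=> ez eL.
apply/eqP; rewrite -(eqr_nat R) -muln2 natrM; apply/eqP; lra.
Qed.

(** A second vertex in the branch yields a leaf in it, at level [k] and so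
    different from both ends, while other leaves have level [L / 2]. *)
Lemma trivial_branch k y :
  (0 < k < L)%N -> k.*2 <> L -> y \in branch e x k -> y = x k.
Proof.
move=> kL k2 yk; apply/eqP.
apply: contra_notT k2 => /(branch_leaf tree_e kL yk)[z z_leaf zk].
have levz := branch_level tree_e walk_x inj_x kL zk.
rewrite -levz leaf_level //.
- apply: contraTneq kL => zx; rewrite -levz zx.
  by rewrite (level_walk tree_e walk_x inj_x).
- apply: contraTneq kL => zx; rewrite -levz zx.
  by rewrite (level_walk tree_e walk_x inj_x) // ltnn andbF.
Qed.

End Equality.
End DiametralTest.

Theorem theorem1p3 (R : realType) (V : finType) (e : rel V)
    (tree_e : is_tree e) (card_V : (3 <= #|V|)%N) :
  let L := diameter e in
  let lambda2 : R := steklov_eigenvalue R e 2 in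
  lambda2 <= 2 / L%:R /\
  forall x : nat -> V,
    (forall k : nat, (k < L)%N -> e (x k) (x k.+1)) ->
    x 0%N \in boundary e -> x L \in boundary e -> dist e (x 0%N) (x L) = L ->
    lambda2 = 2 / L%:R ->
    (~~ odd L ->
       forall k : nat, (1 <= k <= L - 1)%N -> k <> L./2 ->
         #|branch e x k| = 1%N) /\
    (odd L -> is_path_graph e).
Proof.
move=> L lambda2.
have L_gt0 := diameter_gt0 tree_e (ltnW card_V).
split.
  have [x [walk_x dist_x x0_leaf xL_leaf]] :=
    diametral_walk tree_e (ltnW card_V).
  exact: (lambda2_le_length R tree_e card_V L_gt0 walk_x
    (geodesic_inj tree_e walk_x dist_x) x0_leaf xL_leaf).
move=> x walk_x x0_leaf xL_leaf dist_x lambda2E.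
have inj_x := geodesic_inj tree_e walk_x dist_x.
have triv := trivial_branch tree_e card_V L_gt0 walk_x inj_x x0_leaf xL_leaf
  lambda2E.
split=> [_ k /andP[k_gt0 k_le] k_half|odd_L].
  have kL : (0 < k < L)%N.
    by rewrite k_gt0 (leq_ltn_trans k_le) // subn1 ltn_predL.
  apply/eqP/cards1P; exists (x k); apply/setP => y; rewrite [RHS]inE.
  apply/idP/eqP => [|->]; last by rewrite inE connect0.
  apply: triv => // k2; apply: k_half.
  by rewrite -[LHS]doubleK k2.
apply: (trivial_branches_path_graph tree_e walk_x inj_x) => // k y kL.
by apply: triv => // k2; move: odd_L; rewrite /L -k2 odd_double.
Qed.
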